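(* For each integer $r\ge 2$ there exists an integer $n_r$ such that for all $n\ge n_r$ there exist infinitely many pairwise non-isomorphic minimal $1/r$-Ramsey graphs for $K_n$. Moreover, one can take $n_2=3$; that is, for every $n\ge 3$ there exist infinitely many pairwise non-isomorphic minimal $1/2$-Ramsey graphs for $K_n$.
   Context: All graphs are finite and simple. For a graph $H$ and a positive integer $r$, a graph $G$ is a $1/r$-Ramsey graph for $H$ if every colouring of $E(G)$ with $r+1$ colours admits a copy of $H$ in $G$ (a not necessarily induced subgraph isomorphic to $H$) whose edges use at most $r$ of the colours. It is a minimal $1/r$-Ramsey graph for $H$ if moreover no proper subgraph of $G$ is a $1/r$-Ramsey graph for $H$. *)

(* Defs.v *)
From HB Require Import structures.
From mathcomp Require Import all_boot.

Set Implicit Arguments.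
Unset Strict Implicit.
Unset Printing Implicit Defensive.

Record sgraph := SGraph {
  vertex :> finType;
  adj : rel vertex;
  adj_sym : symmetric adj;
  adj_irr : irreflexive adj }.

Definition edges (G : sgraph) : {set {set G}} :=
  [set [set x; y] | x in [set: G], y in [set: G] & adj x y].

Lemma edges_card2 (G : sgraph) (e : {set G}) : e \in edges G -> #|e| = 2.
Proof.
case/imset2P=> x y _; rewrite !inE => /= xy ->.
by rewrite cards2; case: eqP xy => // ->; rewrite adj_irr.
Qed.

Lemma edgesE (G : sgraph) (x y : G) : ([set x; y] \in edges G) = adj x y.
Proof.
apply/idP/idP=> [xyE | xy]; last by apply/imset2P; exists x y; rewrite ?inE.
have xDy : x != y by have := edges_card2 xyE; rewrite cards2; case: eqP.
case/imset2P: xyE => u v _; rewrite !inE => /= uv /setP E.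
have := E x; have := E y; rewrite !inE !eqxx orbT /= => /esym Ey /esym Ex.
case/orP: Ex xDy => /eqP ->; case/orP: Ey => /eqP ->; rewrite ?eqxx // => _.
by rewrite adj_sym.
Qed.

Definition isomorphic (G H : sgraph) : Prop :=
  exists f : G -> H, bijective f /\ forall x y, adj (f x) (f y) = adj x y.

Record subgraph (G : sgraph) := Subgraph {
  sub_vertices : {set G};
  sub_edges : {set {set G}};
  sub_edgesP : sub_edges \subset edges G;
  sub_incidP : forall e, e \in sub_edges -> e \subset sub_vertices }.

Section SubgraphGraph.
Variables (G : sgraph) (S : subgraph G).

Definition sub_adj : rel {x : G | x \in sub_vertices S} :=
  fun x y => [set val x; val y] \in sub_edges S.

Lemma sub_adj_sym : symmetric sub_adj.
Proof. by move=> x y; rewrite /sub_adj setUC. Qed.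

Lemma sub_adj_irr : irreflexive sub_adj.
Proof.
move=> x; apply/negP=> /(subsetP (sub_edgesP S)).
by rewrite edgesE adj_irr.
Qed.

Definition sgraph_of_subgraph : sgraph := SGraph sub_adj_sym sub_adj_irr.

Definition proper_subgraph : Prop :=
  sub_vertices S != [set: G] \/ sub_edges S != edges G.

End SubgraphGraph.

Definition is_copy (H G : sgraph) (S : subgraph G) : Prop :=
  isomorphic (sgraph_of_subgraph S) H.

(* An edge colouring is a total function on vertex sets; only its values on
   [edges G] matter, since the subgraphs of G have their edges there. *)
Definition fractional_ramsey (r : nat) (H G : sgraph) : Prop :=
  forall c : {set G} -> 'I_r.+1,
    exists S : subgraph G, is_copy H S /\ #|c @: sub_edges S| <= r.

Definition minimal_fractional_ramsey (r : nat) (H G : sgraph) : Prop :=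
  fractional_ramsey r H G /\
  forall S : subgraph G, proper_subgraph S ->
    ~ fractional_ramsey r H (sgraph_of_subgraph S).

Definition complete_adj (n : nat) : rel 'I_n := fun x y => x != y.

Lemma complete_adj_sym n : symmetric (@complete_adj n).
Proof. by move=> x y; rewrite /complete_adj eq_sym. Qed.

Lemma complete_adj_irr n : irreflexive (@complete_adj n).
Proof. by move=> x; rewrite /complete_adj eqxx. Qed.

Definition complete_graph (n : nat) : sgraph :=
  SGraph (@complete_adj_sym n) (@complete_adj_irr n).

Definition infinitely_many_graphs (P : sgraph -> Prop) : Prop :=
  exists F : nat -> sgraph,
    (forall i, P (F i)) /\ (forall i j, i <> j -> ~ isomorphic (F i) (F j)).

(* Main.v *)
(** Let [m = 2n - 3]. Colouring the edge [xy] of [K_m] by [x + y mod m] makes every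
    [n]-subset see all [m >= r + 1] colours, since [m] is odd and a set of more than
    half of [Z/m] meets its reflections; hence no graph with an [m]-colouring of its
    vertices is Ramsey. Conversely, call a clique [v_1, ..., v_m] end-homogeneous if the
    colour of [v_i v_j], [i < j], depends only on [i]. As [r + 1 >= 3], some colour
    occurs at few of the [m - 1 = 2(n - 2)] vertices before the last, so an
    end-homogeneous [K_m] contains a [K_n] missing that colour. It thus
    suffices to find graphs in which every edge colouring has an end-homogeneous [K_m]
    although all small subgraphs are [m]-colourable: their minimal Ramsey subgraphs are
    arbitrarily large. Such graphs are built by induction on [m]: place copies of the
    graph for [m] on the edges of a locally acyclic uniform hypergraph of large
    chromatic number and join a new vertex to everything. The hypergraphs come from
    the partite construction of Nešetřil and Rödl. *)

From Stdlib Require Import ClassicalEpsilon.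
Require Import Defs.
From mathcomp Require Import all_boot perm zify.

Set Implicit Arguments.
Unset Strict Implicit.
Unset Printing Implicit Defensive.

(** * Sparse hypergraphs *)

Definition uniform (V I : finType) (s : nat) (E : I -> {set V}) : Prop :=
  forall i, #|E i| = s.

(* At least [(s - 1) * #|S| + 1] vertices are covered, the number for an [s]-uniform
   hypertree; this is written so as to avoid truncated subtraction. *)
Definition sparse (V I : finType) (s N : nat) (E : I -> {set V}) : Prop :=
  forall S : {set I}, 0 < #|S| <= N ->
    s * #|S| < #|\bigcup_(i in S) E i| + #|S|.

Definition vertex_ramsey (V I C : finType) (E : I -> {set V}) : Prop :=
  forall c : V -> C, exists i a, forall u, u \in E i -> c u = a.

(** Double counting, with [d u] the number of edges of [S] through [u]. Without a leaf, the degrees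
    plus the private incidences add up to at most (2s - 2)|S|; each covered vertex contributes at
    least 2, so at most (s - 1)|S| vertices are covered. *)
Lemma sparse_leaf (V I : finType) (s N : nat) (E : I -> {set V}) (S : {set I}) :
  uniform s E -> sparse s N E -> 0 < #|S| <= N ->
  exists2 i, i \in S &
    #|E i :&: \bigcup_(j in S :\ i) E j| <= 1.
Proof.
move=> Es Esp SN; apply/exists_inP; apply: contraTT (Esp S SN).
rewrite negb_exists_in -leqNgt => /forall_inP noleaf.
pose d u := \sum_(i in S) (u \in E i).
have sumd : \sum_u d u = s * #|S|.
  rewrite exchange_big /= mulnC -sum_nat_const; apply: eq_bigr => i _.
  rewrite -(Es i) -sum1_card [RHS]big_mkcond; apply: eq_bigr => u _.
  by case: (u \in _).
(* Otherwise each edge has at most [s - 2] private vertices, and counting private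
   incidences twice contradicts sparseness. *)
have priv i : i \in S -> \sum_(u in E i) (d u == 1) + 2 <= s.
  move=> iS; rewrite -(Es i) -(cardsID (\bigcup_(j in S :\ i) E j) (E i)) addnC.
  apply: leq_add; first by rewrite ltnNge noleaf.
  rewrite -sum1_card big_mkcond [leqRHS]big_mkcond; apply: leq_sum => u _.
  rewrite inE; case: (boolP (u \in E i)) => uEi; rewrite ?andbF ?andbT //.
  case: (boolP (u \in \bigcup_(j in S :\ i) E j)) => [|_]; last exact: leq_b1.
  case/bigcupP=> j.
  rewrite !inE => /andP[ji jS] uEj.
  by rewrite /d (bigD1 i) //= (bigD1 j) ?jS //= uEi uEj.
have : \sum_u (d u + d u * (d u == 1)) <= (2 * s - 2) * #|S|.
  rewrite big_split /= sumd.
  have -> : \sum_u d u * (d u == 1) = \sum_(i in S) \sum_(u in E i) (d u == 1).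
    under eq_bigr => u _ do rewrite {1}/d big_distrl /=.
    rewrite exchange_big /=; apply: eq_bigr => i _; rewrite [RHS]big_mkcond.
    by apply: eq_bigr => u _; case: (u \in E i); rewrite ?mul1n ?mul0n.
  rewrite [s * _]mulnC -sum_nat_const -big_split /= mulnC -sum_nat_const.
  by apply: leq_sum => i /priv; lia.
have : 2 * #|\bigcup_(i in S) E i| <= \sum_u (d u + d u * (d u == 1)).
  rewrite mulnC -sum_nat_const big_mkcond; apply: leq_sum => u _.
  case: ifP => // /bigcupP[i iS uE].
  have : 0 < d u by rewrite /d (bigD1 i) //= uE.
  by case: (d u) => [|[|k]].
have s_ge2 : 2 <= s.
  have /card_gt0P[i /priv] : 0 < #|S| by case/andP: SN.
  exact: leq_trans (leq_addl _ _).
rewrite mulnBl; move: (leq_mul2r #|S| 2 s); rewrite s_ge2 orbT;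
lia.
Qed.

(** Colourings chosen independently on the edges merge, up to renaming colours on each edge. Peel
    off a leaf: it meets the rest in at most one vertex, and a transposition of colours gives
    agreement there. *)
Lemma sparse_consistent (V I : finType) (k s N : nat) (E : I -> {set V})
    (g : I -> V -> 'I_k.+1) (S : {set I}) :
  uniform s E -> sparse s N E -> #|S| <= N ->
  exists f : V -> 'I_k.+1, forall i, i \in S ->
    exists2 t : 'I_k.+1 -> 'I_k.+1, injective t &
      forall u, u \in E i -> f u = t (g i u).
Proof.
move=> Es Esp; have [m] := ubnP #|S|; elim: m S => // m IH S Sm SN.
have [S0 | Spos] := posnP #|S|.
  by exists (fun=> ord0) => i; rewrite (cards0_eq S0) inE.
have /(sparse_leaf Es Esp)[i iS leaf] : 0 < #|S| <= N by rewrite Spos.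
have [] := IH (S :\ i); first 2 last.
- move=> f fP.
  have [t tinj tP] : exists2 t : 'I_k.+1 -> 'I_k.+1, injective t &
      forall u, u \in E i :&: \bigcup_(j in S :\ i) E j -> f u = t (g i u).
    have [/eqP K0 | Kn0] := boolP (E i :&: \bigcup_(j in S :\ i) E j == set0).
      by exists id => // u; rewrite K0 inE.
    have /set0Pn[x xK] := Kn0.
    exists (tperm (g i x) (f x)); first exact: perm_inj.
    move=> u uK; rewrite (card_le1_eqP leaf u x) //.
    by rewrite tpermL.
  exists (fun u => if u \in E i then t (g i u) else f u) => j jS.
  have [->|ji] := eqVneq j i; first by exists t => // u ->.
  have [|t' t'inj t'P] := fP j; first by rewrite !inE ji.
  exists t' => // u uEj; case: ifP => uEi; last exact: t'P.
  rewrite -tP ?t'P // inE uEi; apply/bigcupP.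
  by exists j; rewrite // !inE ji.
- by move: Sm; rewrite (cardsD1 i) iS.
- by apply: leq_trans SN; rewrite subset_leq_card // subsetDl.
Qed.

(* A copy of [V] indexed by [h], in which [A] is identified with [F h]. Vertices
   outside [A] have index [#|A| = #|F h|] and so get the default [inr (h, v)]. *)
Definition glue (U V J : finType) (F : J -> {set U}) (A : {set V})
    (h : J) (v : V) : U + J * V :=
  nth (inr (h, v)) [seq inl u | u <- enum (F h)] (index v (enum A)).

Lemma glue_in (U V J : finType) (F : J -> {set U}) (A : {set V}) h v :
  #|F h| = #|A| -> v \in A -> exists2 u, u \in F h & glue F A h v = inl u.
Proof.
move=> FA vA.
have lt_i : index v (enum A) < size (enum (F h)).
  by rewrite -cardE FA cardE index_mem mem_enum.
have [u0 _] : exists u0, u0 \in F h.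
  by apply/card_gt0P; rewrite cardE; apply: leq_ltn_trans lt_i.
exists (nth u0 (enum (F h)) (index v (enum A))).
  by rewrite -mem_enum mem_nth.
by rewrite /glue (nth_map u0).
Qed.

Lemma glue_out (U V J : finType) (F : J -> {set U}) (A : {set V}) h v :
  #|F h| = #|A| -> v \notin A -> glue F A h v = inr (h, v).
Proof.
move=> FA vA; rewrite /glue nth_default // size_map -cardE FA cardE.
by rewrite leqNgt index_mem mem_enum.
Qed.

Lemma glue_inj (U V J : finType) (F : J -> {set U}) (A : {set V}) h :
  #|F h| = #|A| -> injective (glue F A h).
Proof.
move=> FA v v'.
have [vA|vA] := boolP (v \in A); have [v'A|v'A] := boolP (v' \in A).
- have lt_i w : w \in A ->
      index w (enum A) < size [seq @inl U (J * V) u | u <- enum (F h)].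
    by move=> wA; rewrite size_map -cardE FA cardE index_mem mem_enum.
  rewrite /glue (set_nth_default (inr (h, v'))) ?lt_i // => /eqP.
  rewrite nth_uniq ?lt_i // ?map_inj_uniq ?enum_uniq => [||x y []] //.
  by move/eqP/(index_inj v); apply; rewrite mem_enum.
- by have [u _ ->] := glue_in FA vA; rewrite glue_out.
- by have [u _ ->] := glue_in FA v'A; rewrite glue_out.
- by rewrite !glue_out // => -[].
Qed.

Definition amalgam (U V J I : finType) (F : J -> {set U}) (E : I -> {set V})
    (A : {set V}) (hi : J * I) : {set U + J * V} :=
  glue F A hi.1 @: E hi.2.

(* Sparseness of [F] is needed one level below that of the result: [N.+1] edges in
   distinct copies are single edges, which meet [A] in at most one vertex. *)
Lemma sparse_amalgam (U V J I : finType) (s N : nat)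
    (F : J -> {set U}) (E : I -> {set V}) (A : {set V}) :
  (forall h, #|F h| = #|A|) -> sparse #|A| N F -> sparse s N.+1 E ->
  (forall i, #|E i :&: A| <= 1) -> sparse s N.+1 (amalgam F E A).
Proof.
move=> FA Fsp Esp EA S /andP[S0 SN].
(* [T] collects the copies met by [S]; [C h] is the trace on [U] of what [S] covers in copy [h]. *)
pose T := [set hi.1 | hi in S]; pose Sh h := [set i | (h, i) \in S].
pose B h := \bigcup_(i in Sh h) E i.
pose C h := [set u | inl u \in glue F A h @: B h].
have ShT h : h \in T -> 0 < #|Sh h|.
  by case/imsetP=> [[h' i] hiS ->]; apply/card_gt0P; exists i; rewrite inE.
have ShS h : #|Sh h| <= #|S|.
  have pair_inj : injective (pair h : I -> J * I) by move=> i i' [].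
  rewrite -(card_imset _ pair_inj); apply: subset_leq_card.
  by apply/subsetP=> _ /imsetP[i iS ->]; rewrite inE in iS.
have cardS : #|S| = \sum_(h in T) #|Sh h|.
  under eq_bigr => h _ do rewrite -sum1_card.
  rewrite -sum1_card pair_big_dep /=; apply: eq_bigl => -[h i] /=.
  rewrite inE andb_idl // => hiS; by apply/imsetP; exists (h, i).
have T0 : 0 < #|T|.
  by case/card_gt0P: S0 => hi hiS; apply/card_gt0P; exists hi.1; apply: imset_f.
have TS : #|T| <= #|S| by apply: leq_imset_card.
have cardC h : #|C h| = #|B h :&: A|.
  rewrite -(card_imset _ (glue_inj (FA h))).
  rewrite -(card_imset (C h) (@inl_inj _ (J * V))).
  apply: eq_card => x; apply/imsetP/imsetP => [[u]|[v]].
    rewrite inE => /imsetP[v vB e] ->; exists v => //; rewrite inE vB.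
    by apply: contraT => vA; rewrite glue_out in e.
  rewrite inE => /andP[vB vA] ->; have [u _ e] := glue_in (FA h) vA.
  by exists u => //; rewrite inE -e imset_f.
have CF h : C h \subset F h.
  apply/subsetP=> u; rewrite inE => /imsetP[v _ e].
  have [vA|vA] := boolP (v \in A); last by rewrite glue_out in e.
  by have [u' u'F e'] := glue_in (FA h) vA; move: e; rewrite e' => -[->].
(* For at most [N] copies, the bound holds for the full edges [F h], and shrinking them to [C h]
   lowers the union by no more than the sum. *)
have sumC : \sum_(h in T) #|C h| < #|\bigcup_(h in T) C h| + #|T|.
  have [TN|NT] := leqP #|T| N.
    have := Fsp T; rewrite T0 TN => /(_ isT).
    have : #|\bigcup_(h in T) F h| <=
           #|\bigcup_(h in T) C h| + \sum_(h in T) #|F h :\: C h|.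
      apply: (@leq_trans #|\bigcup_(h in T) C h :|: \bigcup_(h in T) (F h :\: C h)|).
        apply: subset_leq_card; apply/bigcupsP => h hT; apply/subsetP => u uF.
        rewrite inE; case: (boolP (u \in C h)) => uC; apply/orP; [left|right].
          by apply/bigcupP; exists h.
        by apply/bigcupP; exists h; rewrite // inE uC.
      apply: leq_trans (leq_card_setU _ _) _; rewrite leq_add2l.
      elim/big_rec2: _ => [|h m D _ le_Dm]; first by rewrite cards0.
      by apply: leq_trans (leq_card_setU _ _) _; rewrite leq_add2l.
    have : \sum_(h in T) #|C h| + \sum_(h in T) #|F h :\: C h| = #|A| * #|T|.
      rewrite -big_split mulnC -sum_nat_const; apply: eq_bigr => h _ /=.
      by rewrite -(FA h) -(cardsID (C h) (F h)) (setIidPr (CF h)).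
    lia.
  have C1 h : h \in T -> #|C h| <= 1.
    have /imset_injP Tinj : #|T| == #|S| by rewrite eqn_leq TS (leq_trans SN).
    move=> hT; rewrite cardC; apply/card_le1_eqP => v v'.
    rewrite !inE => /andP[/bigcupP[i iS vi] vA] /andP[/bigcupP[i' i'S vi'] v'A].
    rewrite !inE in iS i'S; have [ii'] := Tinj _ _ iS i'S erefl.
    by apply: (card_le1_eqP (EA i)); rewrite inE ?vi // ii' vi'.
  have [U0|] := posnP #|\bigcup_(h in T) C h|.
    rewrite big1 ?U0 // => h hT; apply/eqP; rewrite -leqn0 -U0.
    by apply: subset_leq_card; apply: bigcup_sup.
  have : \sum_(h in T) #|C h| <= #|T| by rewrite -sum1_card; apply: leq_sum.
  lia.
(* Sparseness of [E] within each copy, summed over the copies. *)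
have sumB : s * #|S| + #|T| <= \sum_(h in T) #|B h| + #|S|.
  rewrite {1 2}cardS -sum1_card big_distrr -!big_split /=; apply: leq_sum => h hT.
  rewrite addn1; apply: Esp; rewrite ShT //; exact: leq_trans (ShS h) SN.
have sumBI : \sum_(h in T) #|B h| = \sum_(h in T) #|C h| + \sum_(h in T) #|B h :\: A|.
  by rewrite -big_split; apply: eq_bigr => h _; rewrite -(cardsID A (B h)) cardC.
have : #|\bigcup_(h in T) C h| + \sum_(h in T) #|B h :\: A|
       <= #|\bigcup_(hi in S) amalgam F E A hi|.
  pose P := [set hv : J * V | (hv.1 \in T) && (hv.2 \in B hv.1 :\: A)].
  have -> : \sum_(h in T) #|B h :\: A| = #|P|.
    under eq_bigr => h _ do rewrite -sum1_card.
    by rewrite pair_big_dep -sum1_card /=; apply: eq_bigl => hv; rewrite !inE.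
  rewrite -(card_imset _ (@inl_inj U (J * V))) -(card_imset P (@inr_inj U _)).
  rewrite -cardsUI (_ : _ :&: _ = set0) ?cards0 ?addn0; last first.
    apply/setP=> x; rewrite !inE; apply/negP => /andP[/imsetP[u _ ->]].
    by case/imsetP.
  apply: subset_leq_card; rewrite subUset; apply/andP; split; apply/subsetP=> x.
    case/imsetP=> u /bigcupP[h hT]; rewrite inE => /imsetP[v /bigcupP[i]].
    rewrite inE => hiS vE -> ->; apply/bigcupP; exists (h, i) => //.
    exact: imset_f.
  case/imsetP=> -[h v]; rewrite !inE /= => /and3P[hT vA /bigcupP[i]].
  rewrite inE => hiS vE ->; apply/bigcupP; exists (h, i) => //.
  by apply/imsetP; exists v; rewrite ?glue_out.
lia.
Qed.

(** * Pigeonhole and the partite construction *)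

Lemma monochromatic_subset (T C : finType) (c0 : C) (s : nat) (f : T -> C) :
  s * #|C| <= #|T| ->
  exists A : {set T}, #|A| = s /\ exists a, forall x, x \in A -> f x = a.
Proof.
move=> sCT; have [a sa] : exists a, s <= #|f @^-1: [set a]|.
  apply/existsP; apply: contraT; rewrite negb_exists => /forallP small.
  have [s0|s_gt0] := posnP s; first by have := small c0; rewrite s0.
  have : \sum_a #|f @^-1: [set a]| = #|T|.
    rewrite -[RHS]sum1_card (partition_big f predT) //=.
    apply: eq_bigr => a _; rewrite -sum1_card; apply: eq_bigl => i.
    by rewrite !inE.
  have : \sum_a #|f @^-1: [set a]| <= \sum_(a : C) s.-1.
    by apply: leq_sum => a _; have := small a; lia.
  rewrite (_ : \sum_a s.-1 = #|C| * s.-1) ?sum_nat_const //.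
  have : 0 < #|C| by apply/card_gt0P; exists c0.
  move: sCT; rewrite -{1}(prednK s_gt0) mulSn [s.-1 * _]mulnC; lia.
have /card_gt0P[A] : 0 < #|[set A in powerset (f @^-1: [set a]) | #|A| == s]|.
  rewrite (_ : [set _ in _ | _] =
               [set A : {set T} | A \subset f @^-1: [set a] & #|A| == s]).
    by rewrite cards_draws bin_gt0.
  by apply/setP => A; rewrite !inE.
rewrite !inE => /andP[/subsetP sAf /eqP cA]; exists A; split=> //.
by exists a => i /sAf; rewrite !inE => /eqP.
Qed.

(** Induction on [N] for all [s] at once, since the step needs edges as large as a whole part. For N
    = 0 sparseness is void and pigeonhole suffices. *)
Lemma sparse_hypergraph (C : finType) (c0 : C) (N s : nat) :
  exists (V I : finType) (E : I -> {set V}),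
    [/\ uniform s E, sparse s N E & vertex_ramsey C E].
Proof.
elim: N s => [|N IHN] s;
    pose a := s * #|C|; pose I := {A : {set 'I_a} | #|A| == s};
    have sCa : s * #|C| <= #|'I_a| by rewrite card_ord.
  exists 'I_a, I, val; split=> [[A /eqP]//|S /andP[]|f]; first lia.
  have [A [/eqP cA mono]] := monochromatic_subset c0 f sCa.
  by exists (exist _ A cA).
(* Stage [j] of the partite construction: colourings constant on the parts [>= j]
   have monochromatic edges. *)
pose stage j := exists (V I : finType) (E : I -> {set V}) (p : V -> 'I_a),
  [/\ uniform s E, sparse s N.+1 E, forall i, {in E i &, injective p} &
      forall c : V -> C, (forall x y, p x = p y -> j <= p x -> c x = c y) ->
        exists i b, forall u, u \in E i -> c u = b].
suff : stage a.
  case=> V [{}I [E [p [Es Esp _ Er]]]]; exists V, I, E; split=> // c.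
  by apply: Er => x y _; rewrite leqNgt ltn_ord.
suff stages j : j <= a -> stage j by apply: stages.
elim: j => [_|j IHj lt_ja].
  (* Disjoint copies of all [s]-subsets of the index set: a colouring constant on parts is a
     colouring of the index set. *)
  pose E (A : I) : {set I * 'I_a} := [set x | (x.1 == A) && (x.2 \in val A)].
  have EE A : E A = pair A @: val A.
    apply/setP=> -[B i]; rewrite !inE /=; apply/andP/imsetP.
      by case=> /eqP-> iA; exists i.
    by case=> k kA [-> ->].
  have Es : uniform s E.
    move=> A; rewrite EE card_imset; last by move=> ? ? [].
    by case: A => A /= /eqP.
  exists (I * 'I_a)%type, I, E, snd; split=> //.
  - move=> S /andP[S0 _]; suff -> : #|\bigcup_(A in S) E A| = s * #|S| by lia.
    rewrite -sum1_card (eq_bigl (fun x => (x.1 \in S) && (x.2 \in val x.1))).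
      rewrite -(pair_big_dep (mem S) (fun B i => i \in val B) (fun _ _ => 1)) /=.
      rewrite mulnC -sum_nat_const; apply: eq_bigr => B _.
      by rewrite sum1_card; case: B => B /= /eqP.
    move=> [B i] /=; apply/bigcupP/andP => [[B' B'S]|[BS iB]].
      by rewrite inE /= => /andP[/eqP-> ->].
    by exists B; rewrite // inE /= eqxx.
  - move=> A [B i] [B' i'] /=; rewrite !inE /=.
    by move=> /andP[/eqP-> _] /andP[/eqP-> _] ->.
  (* [A0] only supplies a first coordinate, hence a representative of each part. *)
  - move=> c cP; have [A0 [/eqP cA0 _]] := monochromatic_subset c0 (fun=> c0) sCa.
    have [A [/eqP cA [b Ab]]] :=
      monochromatic_subset c0 (fun i => c (exist _ A0 cA0, i)) sCa.
    exists (exist _ A cA), b => -[B i]; rewrite !inE /= => /andP[_ /Ab <-].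
    exact: cP.
have [V [{}I [E [p [Es Esp Ep Er]]]]] := IHj (ltnW lt_ja).
(* Copies of the stage [j] hypergraph are glued with part [j] onto the edges of [F]. Over a
   monochromatic edge of [F], part [j] of the copy has constant colour, so stage [j] applies to that
   copy. *)
pose A := [set x | p x == Ordinal lt_ja].
have [U [J [F [Fs Fsp Fr]]]] := IHN #|A|.
pose p' (x : U + J * V) := match x with inl _ => Ordinal lt_ja | inr hv => p hv.2 end.
have p'P h v : p' (glue F A h v) = p v.
  have [vA|vA] := boolP (v \in A); last by rewrite glue_out.
  by have [u _ ->] := glue_in (Fs h) vA; move: vA; rewrite inE => /eqP.
exists (U + J * V)%type, (J * I)%type, (amalgam F E A), p'; split.
- by move=> [h i]; rewrite card_imset ?Es //; apply: glue_inj.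
- apply: sparse_amalgam => // i; apply/card_le1_eqP => x y.
  rewrite !inE => /andP[xE /eqP px] /andP[yE /eqP py].
  by apply: (Ep i); rewrite // px py.
- move=> [h i] _ _ /imsetP[x xE ->] /imsetP[y yE ->]; rewrite !p'P => pxy.
  by rewrite (Ep i x y).
move=> c cP; have [h [b hb]] := Fr (c \o inl).
have [|i [b' ib']] := Er (c \o glue F A h).
- move=> x y pxy; rewrite leq_eqVlt => /orP[/eqP jp | jp] /=.
    have xA : x \in A by rewrite inE -val_eqE /= jp.
    have yA : y \in A by rewrite inE -pxy -val_eqE /= jp.
    have [u uF ->] := glue_in (Fs h) xA; have [u' u'F ->] := glue_in (Fs h) yA.
    by have /= -> := hb u uF; have /= -> := hb u' u'F.
  by apply: cP; rewrite !p'P.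
by exists (h, i), b' => _ /imsetP[u uE ->]; apply: ib'.
Qed.

(** * Locally colourable graphs with end-homogeneous cliques *)

(** Small subgraphs are given by at most [N] ordered pairs. Once [N] reaches the square of the order
    of [G], all of [G] is properly coloured. *)
Definition locally_colorable (N k : nat) (G : sgraph) : Prop :=
  forall L : {set G * G}, #|L| <= N ->
    exists f : G -> 'I_k, forall x y, (x, y) \in L -> adj x y -> f x != f y.

(* The second component of an entry is the colour of its edges to all later ones. *)
Definition end_homogeneous (G : sgraph) (C : finType) (c : {set G} -> C)
    (s : seq (G * C)) : bool :=
  pairwise (fun p q => adj p.1 q.1 && (c [set p.1; q.1] == p.2)) s.

(** * Cones over copies of a graph placed on hyperedges *)

Definition place (G : sgraph) (V I : finType) (E : I -> {set V})
    (Es : uniform #|G| E) (i : I) (x : G) : V :=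
  enum_val (cast_ord (esym (Es i)) (enum_rank x)).

Lemma place_inj (G : sgraph) (V I : finType) (E : I -> {set V})
    (Es : uniform #|G| E) i : injective (place Es i).
Proof. by move=> x y /enum_val_inj/cast_ord_inj/enum_rank_inj. Qed.

Lemma place_in (G : sgraph) (V I : finType) (E : I -> {set V})
    (Es : uniform #|G| E) i x : place Es i x \in E i.
Proof. exact: enum_valP. Qed.

Definition place_adj (G : sgraph) (V I : finType) (E : I -> {set V})
    (Es : uniform #|G| E) (u v : V) (i : I) : bool :=
  [exists x, exists y,
    [&& adj x y, place Es i x == u & place Es i y == v]].

(** [None] is the apex. *)
Definition cone_adj (G : sgraph) (V I : finType) (E : I -> {set V})
    (Es : uniform #|G| E) (a b : option V) : bool :=
  match a, b with
  | Some u, Some v => [exists i, place_adj Es u v i]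
  | None, None => false
  | _, _ => true
  end.

Lemma place_adjP (G : sgraph) (V I : finType) (E : I -> {set V})
    (Es : uniform #|G| E) u v i :
  reflect (exists x y, [/\ adj x y, place Es i x = u & place Es i y = v])
          (place_adj Es u v i).
Proof.
apply: (iffP existsP) => [[x /existsP[y]]|[x [y [xy ux vy]]]].
  by case/and3P=> xy /eqP ux /eqP vy; exists x, y.
by exists x; apply/existsP; exists y; rewrite xy ux vy !eqxx.
Qed.

Lemma cone_adj_sym (G : sgraph) (V I : finType) (E : I -> {set V})
    (Es : uniform #|G| E) : symmetric (cone_adj Es).
Proof.
move=> [u|] [v|] //=; apply: eq_existsb => i.
by apply/place_adjP/place_adjP => -[x [y [xy xu yv]]]; exists y, x; rewrite adj_sym.
Qed.

Lemma cone_adj_irr (G : sgraph) (V I : finType) (E : I -> {set V})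
    (Es : uniform #|G| E) : irreflexive (cone_adj Es).
Proof.
move=> [u|] //=; apply/existsP=> -[i /place_adjP[x [y [xy <- /place_inj yx]]]].
by rewrite yx adj_irr in xy.
Qed.

Definition cone (G : sgraph) (V I : finType) (E : I -> {set V})
    (Es : uniform #|G| E) : sgraph :=
  SGraph (cone_adj_sym Es) (cone_adj_irr Es).

(** Colour the copies of [G] on the few hyperedges that carry [L], merge these colourings by
    sparseness, and give the apex the new colour. *)
Lemma cone_locally_colorable (N k : nat) (G : sgraph) (V I : finType)
    (E : I -> {set V}) (Es : uniform #|G| E) :
  sparse #|G| N E -> locally_colorable N k.+1 G ->
  locally_colorable N k.+2 (cone Es).
Proof.
move=> Esp Gloc L LN.
(* A pair may lie in several copies; keeping one bounds the number of hyperedges by |L|. *)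
pose idx (p : option V * option V) : option I :=
  if p is (Some u, Some v) then [pick i | place_adj Es u v i] else None.
pose S := [set i | Some i \in idx @: L].
have SN : #|S| <= N.
  apply: leq_trans LN; apply: leq_trans (leq_imset_card idx L).
  have Some_inj : injective (@Some I) by move=> i j [].
  rewrite -(card_imset _ Some_inj); apply: subset_leq_card.
  by apply/subsetP=> _ /imsetP[i iS ->]; rewrite inE in iS.
have /fin_all_exists[g gP] i : exists g : G -> 'I_k.+1, forall x y,
    (Some (place Es i x), Some (place Es i y)) \in L -> adj x y -> g x != g y.
  pose h (xy : G * G) := (Some (place Es i xy.1), Some (place Es i xy.2)).
  have h_inj : injective h by move=> [x y] [x' y'] [/place_inj-> /place_inj->].
  have [|g gP] := Gloc (h @^-1: L).
    apply: leq_trans LN; rewrite -(card_imset _ h_inj); apply: subset_leq_card.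
    by apply/subsetP=> _ /imsetP[xy xyL ->]; rewrite inE in xyL.
  by exists g => x y xyL; apply: gP; rewrite inE.
(* The default [ord0] is reached only outside [E i], where merging imposes nothing. *)
pose g' i u := if [pick x | place Es i x == u] is Some x then g i x else ord0.
have g'E i x : g' i (place Es i x) = g i x.
  rewrite /g'; case: pickP => [y /eqP/place_inj->|/(_ x)] //.
  by rewrite eqxx.
have [f fP] := sparse_consistent g' Es Esp SN.
exists (fun a => if a is Some u then lift ord_max (f u) else ord_max).
move=> [u|] [v|] //= uvL; rewrite ?neq_lift 1?eq_sym ?neq_lift //.
move=> /existsP[j ujv].
have [i uiv] : exists2 i, i \in S & place_adj Es u v i.
  have : idx (Some u, Some v) = [pick i | place_adj Es u v i] by [].
  case: pickP => [i uiv idxE | /(_ j)]; last by rewrite ujv.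
  by exists i; rewrite // inE -idxE imset_f.
move=> /place_adjP[x [y [xy xu yv]]].
have [t tinj tP] := fP i uiv.
rewrite (inj_eq (@lift_inj _ _)) -xu -yv !tP ?place_in // (inj_eq tinj) !g'E.
by rewrite eq_sym; apply: gP; rewrite ?xu ?yv.
Qed.

(** Colour each vertex by its edge to the apex. The apex can then precede a clique found in the copy
    on a monochromatic hyperedge. *)
Lemma cone_end_homogeneous (C : finType) (k : nat) (G : sgraph) (V I : finType)
    (E : I -> {set V}) (Es : uniform #|G| E) :
  vertex_ramsey C E ->
  (forall c : {set G} -> C, exists2 s, size s = k & end_homogeneous c s) ->
  forall c : {set cone Es} -> C,
    exists2 s, size s = k.+1 & end_homogeneous c s.
Proof.
move=> Er Gh c; have [i [a ia]] := Er (fun u => c [set None; Some u]).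
pose e x : cone Es := Some (place Es i x).
have [s sk sh] := Gh (fun B => c (e @: B)).
exists ((None, a) :: [seq (e p.1, p.2) | p <- s]); first by rewrite /= size_map sk.
rewrite /end_homogeneous pairwise_cons; apply/andP; split.
  by apply/allP => _ /mapP[p _ ->] /=; rewrite ia ?place_in.
rewrite pairwise_map; apply: sub_pairwise sh => p q /= /andP[pq].
rewrite imsetU !imset_set1 => ->; rewrite andbT.
by apply/existsP; exists i; apply/place_adjP; exists p.1, q.1.
Qed.

Lemma end_homogeneous_graph (C : finType) (c0 : C) (N k : nat) :
  exists2 G : sgraph, locally_colorable N k.+1 G &
    forall c : {set G} -> C, exists2 s, size s = k.+1 & end_homogeneous c s.
Proof.
elim: k => [|k [G Gloc Gh]].
  exists (complete_graph 1) => [L _ | c]; last by exists [:: (ord0, c0)].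
  by exists (fun=> ord0) => x y _; rewrite [x]ord1 [y]ord1 adj_irr.
have [V [I [E [Es Esp Er]]]] := sparse_hypergraph c0 N #|G|.
exists (cone Es); first exact: cone_locally_colorable.
exact: cone_end_homogeneous.
Qed.

(** * Minimal Ramsey graphs *)

(** [B] and its image under the reflection t(x) = a - x mod m share at least two elements. As [m] is
    odd, [t] fixes at most one of them; the other is t(w) for some w in [B] distinct from it. *)
Lemma distinct_sum_mod (m a : nat) (B : {set 'I_m}) :
  odd m -> a < m -> m.+1 < 2 * #|B| ->
  exists x y, [/\ x \in B, y \in B, x != y & (x + y) %% m = a].
Proof.
move=> m_odd lt_am; have m_gt0 : 0 < m by lia.
pose t (x : 'I_m) : 'I_m := Ordinal (ltn_pmod (a + m - x) m_gt0).
have tE (x : 'I_m) : t x = (if x <= a then a - x else a + m - x) :> nat.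
  rewrite /=; have xm := ltn_ord x; case: (leqP x a) => xa.
    by rewrite -addnBAC // modnDr modn_small //; lia.
  by rewrite modn_small //; lia.
have t_inj : injective t.
  move=> x y txy; apply: val_inj => /=.
  have := tE x; rewrite txy tE; have := ltn_ord x; have := ltn_ord y.
  by case: (leqP x a); case: (leqP y a); lia.
have sum_t (x : 'I_m) : (x + t x) %% m = a.
  rewrite tE; have xm := ltn_ord x; case: (leqP x a) => xa.
    by rewrite subnKC // modn_small.
  rewrite addnC subnK; last by lia.
  by rewrite modnDr modn_small.
move=> mB; have : 1 < #|B :&: t @: B|.
  have cardtB : #|t @: B| = #|B| by apply: card_imset.
  have := cardsUI B (t @: B); rewrite cardtB.
  have : #|B :|: t @: B| <= m by rewrite -[leqRHS]card_ord max_card.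
  lia.
case/card_gt1P=> x [y [xBt yBt xy]].
have found z : z \in B :&: t @: B -> z != t z ->
    exists x y, [/\ x \in B, y \in B, x != y & (x + y) %% m = a].
  rewrite inE => /andP[zB /imsetP[w wB zw]] ztz.
  exists w, z; rewrite wB zB zw sum_t; split=> //.
  by apply: contraNneq ztz => wtw; rewrite zw -!wtw.
have [/eqP xtx|] := boolP (x == t x); last exact: found.
have [/eqP yty|] := boolP (y == t y); last exact: found.
case/eqP: xy; apply: val_inj => /=.
have := tE x; have := tE y; rewrite -xtx -yty.
have := odd_double_half m; rewrite m_odd -muln2.
by case: (leqP x a); case: (leqP y a); have := ltn_ord x; have := ltn_ord y; lia.
Qed.

Lemma colorable_not_ramsey (r n m : nat) (G : sgraph) (f : G -> 'I_m) :
  odd m -> r < m -> m.+1 < 2 * n ->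
  (forall x y, adj x y -> f x != f y) ->
  ~ fractional_ramsey r (complete_graph n) G.
Proof.
move=> m_odd rm mn fP.
(* [inord] sends residues above [r] to 0; the residues up to [r], all attained on a copy of K_n,
   already give every colour. *)
pose c (e : {set G}) : 'I_r.+1 := inord ((\sum_(i in f @: e) i) %% m).
case/(_ c)=> S [[h [h_bij hP]]]; apply/negP; rewrite -ltnNge.
rewrite -[X in X <= _](card_ord r.+1); apply: subset_leq_card.
apply/subsetP=> a _.
have edgeS (x y : sgraph_of_subgraph S) : x != y -> [set val x; val y] \in sub_edges S.
  move=> xy; rewrite -[_ \in _]/(adj x y) -hP.
  by apply: contra_neq xy => /(bij_inj h_bij).
pose k (x : sgraph_of_subgraph S) := f (val x).
have k_inj : injective k.
  move=> x y kxy; apply/eqP; apply: contraT => /edgeS/(subsetP (sub_edgesP S)).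
  by rewrite edgesE => /fP; rewrite -/(k x) -/(k y) kxy eqxx.
have [||x' [y' [/imsetP[x _ ->] /imsetP[y _ ->] kxy sum_xy]]] :=
    @distinct_sum_mod m a (k @: setT) m_odd.
- exact: leq_trans (ltn_ord a) rm.
- by rewrite card_imset // cardsT (bij_eq_card h_bij) card_ord.
have xy : x != y by apply: contra_neq kxy => ->.
apply/imsetP; exists [set val x; val y]; first exact: edgeS.
apply: val_inj; rewrite /= /c imsetU !imset_set1 big_setU1 ?inE //= big_set1.
by rewrite -/(k x) -/(k y) sum_xy inordK.
Qed.

(** * The Ramsey property from end-homogeneous cliques *)

Lemma clique_copy (G : sgraph) (K : {set G}) :
  {in K &, forall x y, x != y -> adj x y} ->
  exists2 S : subgraph G, is_copy (complete_graph #|K|) S &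
    forall e, e \in sub_edges S ->
      exists x y, [/\ x \in K, y \in K, x != y & e = [set x; y]].
Proof.
move=> Kadj; pose D := [set [set x; y] | x in K, y in K & x != y].
have DP e : e \in D ->
    exists x y, [/\ x \in K, y \in K, x != y & e = [set x; y]].
  by case/imset2P=> x y xK; rewrite inE => /andP[yK xy] ->; exists x, y.
have DG : D \subset edges G.
  by apply/subsetP=> _ /DP[x [y [xK yK xy ->]]]; rewrite edgesE Kadj.
have DK e : e \in D -> e \subset K.
  by case/DP=> x [y [xK yK _ ->]]; rewrite subUset !sub1set xK.
exists (Subgraph DG DK) => //.
pose h (x : {x | x \in K}) : 'I_#|K| := enum_rank_in (valP x) (val x).
have h_inj : injective h.
  move=> x y /(congr1 enum_val); rewrite !enum_rankK_in ?(valP x) ?(valP y) //.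
  exact: val_inj.
exists h; split; first by apply: inj_card_bij; rewrite // card_ord card_sig.
move=> x y; rewrite /= /complete_adj (inj_eq h_inj) /sub_adj /=.
apply/idP/idP => [xy|/(subsetP DG)].
  by apply/imset2P; exists (val x) (val y); rewrite ?inE ?(valP x) ?(valP y).
by rewrite edgesE; apply: contraTneq => ->; rewrite adj_irr.
Qed.

Lemma pairwise_sym_in (T : eqType) (R : rel T) (s : seq T) :
  symmetric R -> pairwise R s -> {in s &, forall x y, x != y -> R x y}.
Proof.
move=> R_sym; elim: s => //= a s IHs /andP[/allP aR sR] x y.
rewrite !inE => /predU1P[->|xs] /predU1P[->|ys]; rewrite ?eqxx // => xy.
- exact: aR.
- by rewrite R_sym aR.
- exact: IHs.
Qed.

Lemma end_homogeneous_ramsey (r n : nat) (G : sgraph) :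
  2 <= r -> 3 <= n ->
  (forall c : {set G} -> 'I_r.+1,
     exists2 s, size s = (2 * (n - 2)).+1 & end_homogeneous c s) ->
  fractional_ramsey r (complete_graph n) G.
Proof.
(* The last entry [z] has no later vertex, so its colour says nothing; it will close the clique. *)
move=> r2 n3 Gh c; have [s] := Gh c; case/lastP: s => // s z.
rewrite size_rcons => -[sn] sh.
(* Otherwise each of at least three colours occurs at least n - 2 > 0 times among 2(n - 2)
   entries. *)
have [a ca] : exists a, n.-1 <= count (fun p => p.2 != a) s.
  apply/existsP; apply: contraT; rewrite negb_exists => /forallP few.
  have : \sum_a count (fun p => p.2 == a) s = size s.
    elim: (s) => [|p l IHl] /=; first by rewrite big1.
    rewrite big_split IHl (bigD1 p.2) //= eqxx big1 // => a.
    by rewrite eq_sym => /negbTE->.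
  have : \sum_(a : 'I_r.+1) (n - 2) <= \sum_a count (fun p => p.2 == a) s.
    apply: leq_sum => a _; have := few a; rewrite -ltnNge.
    have : count (fun p => p.2 == a) s + count (fun p => p.2 != a) s = size s.
      exact: count_predC.
    by rewrite sn; set x := count _ s; set y := count _ s; lia.
  by rewrite sum_nat_const card_ord sn; nia.
pose R x y := adj x y && (c [set x; y] != a).
pose l := rcons (filter (fun p => p.2 != a) s) z.
have lR : pairwise R (map fst l).
  have : end_homogeneous c l.
    apply: subseq_pairwise sh; rewrite /l -!cats1 cat_subseq //.
    exact: filter_subseq.
  rewrite /l /end_homogeneous pairwise_map; elim: (s) => //= p s' IHs.
  case: ifP => // pa; rewrite rcons_cons !pairwise_cons => /andP[/allP pP /IHs->].
  rewrite andbT; apply/allP => q /pP /andP[pq /eqP cpq] /=.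
  by rewrite /R pq cpq.
pose v := take n (map fst l).
have R_sym : symmetric R by move=> x y; rewrite /R adj_sym setUC.
have vR : pairwise R v by apply: subseq_pairwise lR; apply: take_subseq.
have v_uniq : uniq v by apply: pairwise_uniq vR => x; rewrite /R adj_irr.
have KR := pairwise_sym_in R_sym vR.
have cardK : #|[set x in v]| = n.
  rewrite cardsE (card_uniqP v_uniq) size_take size_map size_rcons size_filter.
  by case: ltnP; lia.
have [|S Sn SP] := @clique_copy G [set x in v].
  by move=> x y; rewrite !inE => xv yv /(KR _ _ xv yv) /andP[].
exists S; rewrite cardK in Sn; split=> //.
rewrite -ltnS -[X in _ < X](card_ord r.+1) -cardsT; apply: proper_card.
apply/properP; split; first exact: subsetT.
exists a; rewrite ?inE //; apply/imsetP=> -[e /SP[x [y [xv yv xy ->]]]] e_a.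
rewrite !inE in xv yv; have := KR _ _ xv yv xy.
by rewrite /R -e_a eqxx andbF.
Qed.

(** * Minimal subgraphs and infinitely many orders *)

Lemma subgraph_locally_colorable (N k : nat) (G : sgraph) (S : subgraph G) :
  locally_colorable N k G -> locally_colorable N k (sgraph_of_subgraph S).
Proof.
move=> Gloc L LN; pose h (p : sgraph_of_subgraph S * sgraph_of_subgraph S) :=
  (val p.1, val p.2).
have [|f fP] := Gloc (h @: L); first exact: leq_trans (leq_imset_card _ _) LN.
exists (fun x => f (val x)) => x y xyL xy; apply: fP.
  by apply/imsetP; exists (x, y).
by rewrite -edgesE (subsetP (sub_edgesP S)).
Qed.

(** The measure for the descent to a minimal graph; a proper subgraph may keep all vertices or all
    edges, so both are counted. *)
Lemma proper_subgraph_size (G : sgraph) (S : subgraph G) :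
  proper_subgraph S ->
  #|sgraph_of_subgraph S| + #|edges (sgraph_of_subgraph S)| < #|G| + #|edges G|.
Proof.
have -> : #|sgraph_of_subgraph S| = #|sub_vertices S| by rewrite card_sig.
have : #|edges (sgraph_of_subgraph S)| <= #|sub_edges S|.
  rewrite -(card_imset _ (imset_inj val_inj)); apply: subset_leq_card.
  apply/subsetP=> _ /imsetP[e /imset2P[x y _ xy ->] ->].
  by rewrite imsetU !imset_set1; rewrite inE in xy; case/andP: xy.
have := subset_leq_card (sub_edgesP S).
have : #|sub_vertices S| <= #|G| by apply: max_card.
move=> VG EG ES [] neq.
  have : #|sub_vertices S| < #|G|.
    by rewrite -cardsT proper_card // properEneq neq subsetT.
  lia.
have : #|sub_edges S| < #|edges G|.
  by rewrite proper_card // properEneq neq sub_edgesP.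
lia.
Qed.

Lemma minimal_ramsey_exists (r N k : nat) (H G : sgraph) :
  fractional_ramsey r H G -> locally_colorable N k G ->
  exists2 M : sgraph, minimal_fractional_ramsey r H M & locally_colorable N k M.
Proof.
have [m] := ubnP (#|G| + #|edges G|); elim: m G => // m IHm G Gm GR Gloc.
have [min|notmin] := classic (forall S : subgraph G, proper_subgraph S ->
    ~ fractional_ramsey r H (sgraph_of_subgraph S)).
  by exists G.
have [S SP] : exists S : subgraph G,
    ~ (proper_subgraph S -> ~ fractional_ramsey r H (sgraph_of_subgraph S)).
  exact: not_all_ex_not notmin.
have [Sprop SR] := imply_to_and _ _ SP.
apply: IHm (NNPP _ SR) _; last exact: subgraph_locally_colorable.
exact: leq_trans (proper_subgraph_size Sprop) Gm.
Qed.

(** A minimal graph on at most [N] vertices has at most [N * N] pairs, so it would be m-colourable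
    with m = 2n - 3 odd; [r + 3 < 2 * n] says that r < m. *)
Lemma large_minimal_ramsey (r n N : nat) :
  2 <= r -> 3 <= n -> r + 3 < 2 * n ->
  exists2 G, minimal_fractional_ramsey r (complete_graph n) G & N < #|G|.
Proof.
move=> r2 n3 rn; pose m := (2 * (n - 2)).+1.
have [G Gloc Gh] := end_homogeneous_graph (ord0 : 'I_r.+1) (N * N) (2 * (n - 2)).
have GR := end_homogeneous_ramsey r2 n3 Gh.
have [M [MR Mmin] Mloc] := minimal_ramsey_exists GR Gloc.
exists M; first by split.
rewrite ltnNge; apply/negP=> MN; have [|f fP] := Mloc setT.
  by rewrite cardsT card_prod leq_mul.
apply: (colorable_not_ramsey (f := f)) MR; try by rewrite ?oddS ?oddM; lia.
by move=> x y; apply: fP; rewrite inE.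
Qed.

Lemma infinitely_many_of_unbounded (P : sgraph -> Prop) :
  (forall N, exists2 G, P G & N < #|G|) -> infinitely_many_graphs P.
Proof.
move=> unb; have unb' N : exists G, P G /\ N < #|G| by have [G] := unb N; exists G.
pose g N := proj1_sig (constructive_indefinite_description _ (unb' N)).
have gP N : P (g N) /\ N < #|g N|.
  exact: proj2_sig (constructive_indefinite_description _ (unb' N)).
(* Each graph is chosen larger than the previous one, so the orders strictly increase. *)
pose F := fix F i := if i is j.+1 then g #|F j| else g 0.
exists F; split=> [[|i]|i j]; [exact: (gP _).1..|].
have F_mono : {mono (fun i => #|F i|) : i j / i < j}.
  by apply/leqW_mono/leq_mono/(homo_ltn ltn_trans) => k; apply: (gP _).2.
move=> ij [f [f_bij _]]; apply: ij; apply: (incn_inj (f := fun i => #|F i|)).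
  by apply/leq_mono => x y xy; rewrite F_mono.
exact: bij_eq_card f_bij.
Qed.

Theorem theorem1p4 :
  (forall r : nat, 2 <= r ->
     exists nr : nat, forall n : nat, nr <= n ->
       infinitely_many_graphs
         (minimal_fractional_ramsey r (complete_graph n)))
  /\
  (forall n : nat, 3 <= n ->
     infinitely_many_graphs
       (minimal_fractional_ramsey 2 (complete_graph n))).
Proof.
split=> [r r2 | n n3].
  exists r.+3 => n rn; apply: infinitely_many_of_unbounded => N.
  by apply: large_minimal_ramsey; lia.
by apply: infinitely_many_of_unbounded => N; apply: large_minimal_ramsey; lia.
Qed.
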